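(* Let $\mathcal{M}$ be a Minsky machine satisfying the standing assumptions below. Let $f$ be an $n$-ary operation on $A(\mathcal{M})$ preserving every relation of $\mathbb{A}(\mathcal{M})$ of arity at most $m-1$, let $g_1,\dots,g_n\in A(\mathcal{M})^m$, and suppose the subuniverse $R$ of $A(\mathcal{M})^m$ generated by $\{g_1,\dots,g_n\}$ is computational and non-halting. Suppose $f(g_1,\dots,g_n)=\alpha\in Y^m$, $|[m]\setminus\mathcal{D}(R)|\ge11$, and there is at most one $k\notin\mathcal{N}(R)$ such that $\alpha(\neq k)\in R_I(\neq k)$. Then $\alpha\in R$.
   Context: Minsky machines. A Minsky machine $\mathcal{M}$ has states $\{0,1,\dots,N\}$ ($0$ is the halting state, $1$ the initial state), two registers $A,B$ holding values in $\mathbb{N}$, and a finite set of instructions of the forms $(i,R,j)$ and $(i,R,k,j)$ with $R\in\{A,B\}$. It acts on configurations $(s,\alpha,\beta)\in\{0,\dots,N\}\times\mathbb{N}\times\mathbb{N}$: $\mathcal{M}(i,\alpha,\beta)$ is $(j,\alpha+1,\beta)$ if $(i,A,j)\in\mathcal{M}$; $(j,\alpha,\beta+1)$ if $(i,B,j)\in\mathcal{M}$; $(j,\alpha-1,\beta)$ if $(i,A,k,j)\in\mathcal{M}$ and $\alpha\neq0$; $(j,\alpha,\beta-1)$ if $(i,B,k,j)\in\mathcal{M}$ and $\beta\ne 0$; $(k,\alpha,\beta)$ if $(i,A,k,j)\in\mathcal{M}$ and $\alpha=0$, or $(i,B,k,j)\in\mathcal{M}$ and $\beta=0$; and $(0,\alpha,\beta)$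 if $i=0$. $\mathcal{M}$ halts if $\mathcal{M}^n(1,0,0)$ has state $0$ for some $n$. Standing assumptions on $\mathcal{M}$: it returns both registers to $0$ before halting; it has exactly one instruction $(i,\dots)$ for each non-halting state $i$; the instruction for state $1$ has the form $(1,R,s)$; in the state graph (vertices the states, an edge $i\to j$ iff $\mathcal{M}(i,\alpha,\beta)=(j,\alpha',\beta')$ for some $\alpha,\beta,\alpha',\beta'$) every state is reachable from $1$ and $0$ is reachable from every state; and $\mathcal{M}$ halts with capacity $\kappa$ (it halts and $\alpha+\beta\le\kappa$ whenever $\mathcal{M}^n(1,0,0)=(i,\alpha,\beta)$). The algebra. $A(\mathcal{M})=\{\langle i,c\rangle: 0\le i\le N,\ c\in\{\bullet,\times,0,A,B\}\}$. Put $X=\{\langle i,\times\rangle\}$, $D=\{\langle i,\bullet\rangle\}$, $C=A(\mathcal{M})\setminus(X\cup D)$, $Y=A(\mathcal{M})\setminus X$; $\mathrm{X}(\langle i,c\rangle)=\langle i,\times\rangle$, $\mathrm{State}(\langle i,c\rangle)=i$, $\mathrm{Content}(\langle i,c\rangle)=c$. Write ''$(i,R,\dots,j)\in\mathcal{M}$'' to mean $(i,R,j)\in\mathcal{M}$ or $(i,R,k,j)\in\mathcal{M}$ for some $k$. The operations (cases read in order, first applicable case applies): $\langle i,c\rangle\wedge\langle j,d\rangle$ is $\langle i,c\rangle$ if the two are equal, else $\langle\min(i,j),\times\rangle$. $M(x,y)$: $\langle j,R\rangle$ if $x=\langle i,\bullet\rangle, y=\langle i,0\rangle,(i,R,j)\in\mathcal{M}$;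 $\langle j,0\rangle$ if $x=\langle i,\bullet\rangle,y=\langle i,R\rangle,(i,R,k,j)\in\mathcal{M}$; $\langle j,\bullet\rangle$ if $x=\langle i,0\rangle,y=\langle i,\bullet\rangle,(i,R,j)\in\mathcal{M}$; $\langle j,\bullet\rangle$ if $x=\langle i,R\rangle,y=\langle i,\bullet\rangle,(i,R,k,j)\in\mathcal{M}$; $\langle j,c\rangle$ if $x=y=\langle i,c\rangle$, $c\ne\bullet$, $(i,R,\dots,j)\in\mathcal{M}$; $\langle j,\times\rangle$ if $\mathrm{State}(x)=\mathrm{State}(y)=i$ and $(i,R,\dots,j)\in\mathcal{M}$; otherwise $\mathrm{X}(y)$. $M'(x)$: $\langle k,c\rangle$ if $x=\langle i,c\rangle$, $(i,R,k,j)\in\mathcal{M}$, $c\neq R$; $\langle k,\times\rangle$ if $\mathrm{State}(x)=i$ and $(i,R,k,j)\in\mathcal{M}$; otherwise $\mathrm{X}(x)$. $I(x,y)$: $\langle1,\bullet\rangle$ if $x\in D$; $\langle 1,0\rangle$ if $y\in C$; otherwise $\langle1,\times\rangle$. $H(x)$: $\langle0,0\rangle$ if $x\in\{\langle0,0\rangle,\langle0,\bullet\rangle\}$, otherwise $\langle0,\times\rangle$. $N_0(x,y,z)$: $y$ if $x=\langle0,\bullet\rangle$ and $\mathrm{State}(y)=\mathrm{State}(z)$; $z$ if $x=\langle0,0\rangle$, $z\notin D$, $\mathrm{State}(y)=\mathrm{State}(z)$; otherwise $\mathrm{X}(y\wedge z)$. $S(x,y,z)$: $\langle1,0\rangle$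 if $x=\langle1,0\rangle$, $\mathrm{State}(y)=\mathrm{State}(z)=1$ and $(\mathrm{Content}(y),\mathrm{Content}(z))\in\{(\bullet,0),(0,\bullet),(0,0)\}$; otherwise $\langle1,\times\rangle$. $N_\bullet(u,x,y,z)$, where the first four cases require $\mathrm{State}(x)=\mathrm{State}(y)=\mathrm{State}(z)$: $x$ if $x=y\notin X$; $x$ if $u\in D$, $y\in X$; $y$ if $u\in D$, $x\in X$; $z$ if $u\in D$, $z\in\{x,y\}$; otherwise $\mathrm{X}(x\wedge y\wedge z)$. $P(u,v,x,y)$: $x$ if $\mathrm{State}(u)=\mathrm{State}(v)$, else $y$. $\mathbb{A}(\mathcal{M})=\langle A(\mathcal{M});\wedge,M,M',I,H,N_0,S,N_\bullet,P\rangle$; operations act coordinatewise on powers; relations are subuniverses of powers. Notation and relation notions. For $a\in A(\mathcal{M})^m$ and $J\subseteq[m]$, $a(J)$ is the projection to coordinates $J$, $R(J)$ the projection of $R$, and $a(\neq i)=a([m]\setminus\{i\})$, $R(\neq i)=R([m]\setminus\{i\})$. A tuple is synchronized if its entries all have the same state. $R$ is computational if all its elements are synchronized and each has at most one coordinate in $D$. $R$ (of any arity $p$) is halting if it contains some $r\in\{\langle0,0\rangle,\langle0,\bullet\rangle\}^p\setminus\{\langle0,0\rangle\}^p$, non-halting otherwise. For computational $R$: $\mathcal{D}(R)=\{i\in[m]:R(i)\cap D\ne\emptyset\}$. $R_I$ is the subuniverse of $A(\mathcal{M})^m$ generated by $\{I(a,b):a,b\in R\cap Y^m\}$. For computational non-halting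 $R$, $\mathcal{N}(R)$ denotes a fixed subset $\mathcal{N}\subseteq[m]$ such that $R(\mathcal{N})$ is non-halting, $|\mathcal{N}\cap\mathcal{D}(R)|\le\kappa$, $\mathcal{N}\cap\mathcal{D}(R)\ne\emptyset$ whenever $\mathcal{D}(R)\ne\emptyset$, and $[m]\setminus\mathcal{D}(R)\subseteq\mathcal{N}$ (such a set exists). Standing assumption: the subalgebra of $\mathbb{A}(\mathcal{M})$ generated by $\{\langle1,\bullet\rangle,\langle1,0\rangle\}$ contains $\langle0,\bullet\rangle$. *)

(* Defs.v *)
From Stdlib Require Export Relation_Operators.
From HB Require Import structures.
From mathcomp Require Import all_boot.

Set Implicit Arguments.
Unset Strict Implicit.
Unset Printing Implicit Defensive.

(** * Minsky machines *)

(* The parameter [n] is such that the states are [0, ..., n + 1]: the largest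
   state, usually called [N], is [n.+1], as [1] has to be a state. *)
Definition state (n : nat) := 'I_n.+2.

Definition halt_st {n} : state n := ord0.
Definition init_st {n} : state n := lift ord0 ord0.

Inductive reg := RA | RB.

Definition bool_of_reg (R : reg) := if R is RA then true else false.
Definition reg_of_bool (b : bool) := if b then RA else RB.
Lemma bool_of_regK : cancel bool_of_reg reg_of_bool. Proof. by case. Qed.
HB.instance Definition _ := Finite.copy reg (can_type bool_of_regK).

(* [inl (i, R, j)] is the instruction [(i, R, j)], and
   [inr (i, R, k, j)] is the instruction [(i, R, k, j)]. *)
Definition instr (n : nat) : finType :=
  ((state n * reg * state n) + (state n * reg * state n * state n))%type.

Definition source n (c : instr n) : state n :=
  match c with inl (i, _, _) => i | inr (i, _, _, _) => i end.

Definition machine (n : nat) := {set instr n}.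

(* Meaningful for machines with at most one instruction per state, see
   [one_instr] below. *)
Definition instr_at n (M : machine n) (i : state n) : option (instr n) :=
  [pick c in M | source c == i].

Definition config (n : nat) : Type := (state n * nat * nat)%type.

Definition step n (M : machine n) (c : config n) : config n :=
  let: (i, a, b) := c in
  if i == halt_st then (halt_st, a, b) else
  match instr_at M i with
  | Some (inl (_, RA, j)) => (j, a.+1, b)
  | Some (inl (_, RB, j)) => (j, a, b.+1)
  | Some (inr (_, RA, k, j)) => if a is a'.+1 then (j, a', b) else (k, a, b)
  | Some (inr (_, RB, k, j)) => if b is b'.+1 then (j, a, b') else (k, a, b)
  | None => c
  end.

Definition run n (M : machine n) (t : nat) : config n :=
  iter t (step M) (init_st, 0, 0).

Definition halts n (M : machine n) : Prop :=
  exists t a b, run M t = (halt_st, a, b).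

Definition halts_with_capacity n (M : machine n) (kappa : nat) : Prop :=
  halts M /\ forall t i a b, run M t = (i, a, b) -> a + b <= kappa.

(* The halting state carries no instruction: otherwise the action of the machine
   on configurations would not be well defined. *)
Definition one_instr n (M : machine n) : Prop :=
  (forall i, i != halt_st -> #|[set c in M | source c == i]| = 1) /\
  (forall c, c \in M -> source c != halt_st).

Definition edge n (M : machine n) (i j : state n) : Prop :=
  exists a b a' b', step M (i, a, b) = (j, a', b').

Record standing n (M : machine n) (kappa : nat) : Prop := Standing {
  st_returns : forall t a b, run M t = (halt_st, a, b) -> a = 0 /\ b = 0;
  st_one_instr : one_instr M;
  st_init : exists R s, inl (init_st, R, s) \in M;
  st_from_init : forall i, clos_refl_trans _ (edge M) init_st i;
  st_to_halt : forall i, clos_refl_trans _ (edge M) i halt_st;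
  st_capacity : halts_with_capacity M kappa }.

(** * The algebra A(M) *)

(* [Dot], [Cross], [Zero], [Reg RA], [Reg RB] stand for
   the contents •, ×, 0, A, B. *)
Inductive content := Dot | Cross | Zero | Reg of reg.

Definition content_enc (c : content) : option (option (option reg)) :=
  match c with
  | Dot => None
  | Cross => Some None
  | Zero => Some (Some None)
  | Reg R => Some (Some (Some R))
  end.
Definition content_dec (o : option (option (option reg))) : content :=
  match o with
  | None => Dot
  | Some None => Cross
  | Some (Some None) => Zero
  | Some (Some (Some R)) => Reg R
  end.
Lemma content_encK : cancel content_enc content_dec. Proof. by case. Qed.
HB.instance Definition _ := Finite.copy content (can_type content_encK).

Definition elt (n : nat) : finType := (state n * content)%type.

Definition State n (x : elt n) : state n := x.1.
Definition Content n (x : elt n) : content := x.2.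
Definition toX n (x : elt n) : elt n := (State x, Cross).

Definition inX n (x : elt n) : bool := Content x == Cross.
Definition inD n (x : elt n) : bool := Content x == Dot.
Definition inC n (x : elt n) : bool := ~~ inX x && ~~ inD x.
Definition inY n (x : elt n) : bool := ~~ inX x.

Section Operations.
Variables (n : nat) (M : machine n).
Implicit Types u v x y z : elt n.

Definition meet x y : elt n :=
  if x == y then x
  else ((if State x <= State y then State x else State y), Cross).

Definition opM x y : elt n :=
  if State x != State y then toX y else
  let c := Content x in
  let d := Content y in
  let default := if (c == d) && (c != Dot) then c else Cross in
  match instr_at M (State x) with
  | Some (inl (_, R, j)) =>
      if (c == Dot) && (d == Zero) then (j, Reg R)
      else if (c == Zero) && (d == Dot) then (j, Dot)
      else (j, default)
  | Some (inr (_, R, k, j)) =>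
      if (c == Dot) && (d == Reg R) then (j, Zero)
      else if (c == Reg R) && (d == Dot) then (j, Dot)
      else (j, default)
  | None => toX y
  end.

Definition opM' x : elt n :=
  match instr_at M (State x) with
  | Some (inr (_, R, k, j)) =>
      if Content x != Reg R then (k, Content x) else (k, Cross)
  | _ => toX x
  end.

Definition opI x y : elt n :=
  if inD x then (init_st, Dot)
  else if inC y then (init_st, Zero)
  else (init_st, Cross).

Definition opH x : elt n :=
  if (x == (halt_st, Zero)) || (x == (halt_st, Dot)) then (halt_st, Zero)
  else (halt_st, Cross).

Definition opN0 x y z : elt n :=
  if (x == (halt_st, Dot)) && (State y == State z) then y
  else if [&& x == (halt_st, Zero), ~~ inD z & State y == State z] then z
  else toX (meet y z).

Definition opS x y z : elt n :=
  if [&& x == (init_st, Zero), State y == init_st, State z == init_st &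
      (Content y, Content z) \in [:: (Dot, Zero); (Zero, Dot); (Zero, Zero)]]
  then (init_st, Zero) else (init_st, Cross).

Definition opNdot u x y z : elt n :=
  let sync := (State x == State y) && (State y == State z) in
  if [&& sync, x == y & ~~ inX x] then x
  else if [&& sync, inD u & inX y] then x
  else if [&& sync, inD u & inX x] then y
  else if [&& sync, inD u & (z == x) || (z == y)] then z
  else toX (meet (meet x y) z).

Definition opP u v x y : elt n := if State u == State v then x else y.

End Operations.

(** * Powers, subuniverses and preservation *)

(* Coordinates are indexed by an arbitrary finite type, so that projections onto
   a set [J] of coordinates live in the power indexed by [{i | i \in J}]. *)
Definition power (I : finType) (n : nat) : finType := {ffun I -> elt n}.

Section Relations.
Variables (n : nat) (M : machine n) (I : finType).
Implicit Types (R S G : {set power I n}) (r a b : power I n).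

Definition lift1 (F : elt n -> elt n) a : power I n := [ffun i => F (a i)].
Definition lift2 (F : elt n -> elt n -> elt n) a b : power I n :=
  [ffun i => F (a i) (b i)].
Definition lift3 (F : elt n -> elt n -> elt n -> elt n) a b c : power I n :=
  [ffun i => F (a i) (b i) (c i)].
Definition lift4 (F : elt n -> elt n -> elt n -> elt n -> elt n) a b c d :
    power I n :=
  [ffun i => F (a i) (b i) (c i) (d i)].

Definition closed1 F R := [forall a in R, lift1 F a \in R].
Definition closed2 F R := [forall a in R, forall b in R, lift2 F a b \in R].
Definition closed3 F R :=
  [forall a in R, forall b in R, forall c in R, lift3 F a b c \in R].
Definition closed4 F R :=
  [forall a in R, forall b in R, forall c in R, forall d in R,
     lift4 F a b c d \in R].

Definition subuniverse R : bool :=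
  [&& closed2 (@meet n) R, closed2 (opM M) R, closed1 (opM' M) R,
      closed2 (@opI n) R, closed1 (@opH n) R, closed3 (@opN0 n) R,
      closed3 (@opS n) R, closed4 (@opNdot n) R & closed4 (@opP n) R].

(* The subuniverse generated by [G]. *)
Definition Sg G : {set power I n} :=
  \bigcap_(S : {set power I n} | subuniverse S && (G \subset S)) S.

Definition apply_op k (f : {ffun 'I_k -> elt n} -> elt n)
    (g : 'I_k -> power I n) : power I n :=
  [ffun i => f [ffun l => g l i]].

Definition preserves k (f : {ffun 'I_k -> elt n} -> elt n) R : Prop :=
  forall g : 'I_k -> power I n, (forall l, g l \in R) -> apply_op f g \in R.

Definition proj (J : {set I}) a : power {i | i \in J} n :=
  [ffun j => a (val j)].
Definition projR (J : {set I}) R : {set power {i | i \in J} n} :=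
  [set proj J a | a in R].

Definition Ypow : {set power I n} := [set a : power I n | [forall i, inY (a i)]].

Definition synchronized a : Prop := forall i j, State (a i) = State (a j).

Definition computational R : Prop :=
  forall r, r \in R -> synchronized r /\ #|[set i | inD (r i)]| <= 1.

Definition halting R : Prop :=
  exists2 r, r \in R &
    (forall i, r i = (halt_st, Zero) \/ r i = (halt_st, Dot)) /\
    ~ (forall i, r i = (halt_st, Zero)).

Definition Dset R : {set I} := [set i | [exists r in R, inD (r i)]].

Definition RI R : {set power I n} :=
  Sg [set lift2 (@opI n) a b | a in R :&: Ypow, b in R :&: Ypow].

End Relations.

(* The conditions under which a set [NN] of coordinates can be chosen as N(R). *)
Record isNset n (I : finType) (kappa : nat) (R : {set power I n})
    (NN : {set I}) : Prop := IsNset {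
  Nset_nonhalting : ~ halting (projR NN R);
  Nset_card : #|NN :&: Dset R| <= kappa;
  Nset_meets : Dset R != set0 -> NN :&: Dset R != set0;
  Nset_compl : ~: Dset R \subset NN }.

(* The subalgebra of A(M) is seen as a unary relation. *)
Definition init_generates_halt n (M : machine n) : Prop :=
  [ffun _ : 'I_1 => (halt_st, Dot) : elt n]
    \in Sg M [set [ffun _ : 'I_1 => (init_st, Dot) : elt n];
                  [ffun _ : 'I_1 => (init_st, Zero) : elt n]].

(* Main.v *)
(** A term takes a value outside [X] at a coordinate where no dot occurs only if
    the values it combines there agree, and that value is then one of the values
    of the generators or a reset to [0]. Hence, at the dot-free coordinates, any
    coordinatewise function of contents that returns [0] or one of its arguments
    commutes with terms, and its graph, a relation of low arity, is preserved by
    [f].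

    Five contents and eleven dot-free coordinates give three coordinates on which
    [alpha] has the same content [a]. Replace these three rows of the generators
    by two rows: "[a] if all are [a], else [0]" and "the first nonzero one". The
    resulting relation has arity [m - 1], so it contains the tuple [beta] obtained
    in this way from [alpha]. The two new rows recognise the constant columns [0]
    and [a], and an induction on the generation of [beta] lifts it back to [R].
    The operations [I] and [N_0] may hide the value of one argument at the dot of
    another, hence the induction ranges over the tuples that are outside [X] off
    an arbitrary set [K] of coordinates. *)

Require Import Defs.
From mathcomp Require Import all_boot.

Set Implicit Arguments.
Unset Strict Implicit.
Unset Printing Implicit Defensive.

(** * Single elements *)

Section Pointwise.
Variables (n : nat) (M : machine n).
Implicit Types u v x y z : elt n.

Lemma elt_eq x y : State x = State y -> Content x = Content y -> x = y.
Proof. by case: x => s c; case: y => s' c' /= -> ->. Qed.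

Lemma State_meet x y : State (meet x y) = if State x <= State y then State x else State y.
Proof. by rewrite /meet; case: eqP => [->|//]; case: ifP. Qed.

Lemma meet_Y x y : inY (meet x y) -> x = y.
Proof. by rewrite /meet; case: eqP. Qed.

Lemma meetxx x : meet x x = x.
Proof. by rewrite /meet eqxx. Qed.

Definition stM (s t : state n) : state n :=
  if s != t then t else
  match instr_at M s with
  | Some (inl (_, _, j)) | Some (inr (_, _, _, j)) => j
  | None => t
  end.

Lemma State_opM x y : State (opM M x y) = stM (State x) (State y).
Proof.
rewrite /opM /stM; case: ifP => // _.
by case: instr_at => [[[[i R] j]|[[[i R] k] j]]|] //; case: ifP => // _; case: ifP.
Qed.

(** A dot in the first argument is turned into a register content or [Zero]; only a dot in the
    second argument survives. Outside [X], membership in [D] is therefore read off [y] alone. *)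
Lemma opM_Y x y : inY (opM M x y) ->
  [/\ State x = State y, inY x, inY y & inD (opM M x y) = inD y].
Proof.
rewrite /opM; case: ifPn => [|/negPn/eqP ->]; first by rewrite /inY /inX.
case: x => s c; case: y => t d /=; rewrite /inY /inX /inD /Content /=.
case: instr_at => [[[[i R] j]|[[[i R] k] j]]|] //.
  by case: c => [|||[]]; case: d => [|||[]] //; case: R.
by case: c => [|||[]]; case: d => [|||[]] //; case: R.
Qed.

Lemma opM_C x y : ~~ inD x -> ~~ inD y -> inY (opM M x y) ->
  x = y /\ Content (opM M x y) = Content y.
Proof.
rewrite /opM; case: ifPn => [|/negPn/eqP]; first by rewrite /inY /inX.
case: x => s c; case: y => t d /= ->; rewrite /inY /inX /inD /Content /=.
case: instr_at => [[[[i R] j]|[[[i R] k] j]]|] //.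
  by case: c => [|||[]]; case: d => [|||[]] //; case: R.
by case: c => [|||[]]; case: d => [|||[]] //; case: R.
Qed.

(** Here [x] witnesses that its state carries an instruction; on the diagonal, [opM] then keeps
    every content but the dot. *)
Lemma opM_diag x y : State x = State y -> inY (opM M x x) -> ~~ inD y ->
  Content (opM M y y) = Content y.
Proof.
case: x => s c; case: y => t d /= ->; rewrite /opM !eqxx /= /inY /inX /inD.
case: instr_at => [[[[i R] j]|[[[i R] k] j]]|] //=; rewrite /Content /=.
  by case: d => [|||[]]; case: R.
by case: d => [|||[]]; case: R.
Qed.

Lemma opM_nD x y : ~~ inD x -> ~~ inD y -> ~~ inD (opM M x y).
Proof.
move=> hx hy; case: (boolP (inY (opM M x y))) => [h|]; last first.
  by rewrite /inY negbK /inX /inD => /eqP ->.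
by have [_ _ _ ->] := opM_Y h.
Qed.

Definition stM' (s : state n) : state n :=
  if instr_at M s is Some (inr (_, _, k, _)) then k else s.

Lemma State_opM' x : State (opM' M x) = stM' (State x).
Proof.
rewrite /opM' /stM'; case: instr_at => [[[[i R] j]|[[[i R] k] j]]|] //.
by case: ifP.
Qed.

Lemma opM'_Y x : inY (opM' M x) -> Content (opM' M x) = Content x.
Proof.
rewrite /opM'; case: instr_at => [[[[i R] j]|[[[i R] k] j]]|] //.
by case: ifP.
Qed.

Lemma opM'_nD x : ~~ inD x -> ~~ inD (opM' M x).
Proof.
rewrite /opM'; case: instr_at => [[[[i R] j]|[[[i R] k] j]]|] //.
by case: ifP.
Qed.

(** The only content that [opM'] destroys is the tested register, which is neither [Zero] nor the
    content that survives in [x]. *)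
Lemma opM'_diag x y : State x = State y -> inY (opM' M x) ->
  Content y = Content x \/ Content y = Zero -> Content (opM' M y) = Content y.
Proof.
rewrite /opM' => ->; case: instr_at => [[[[i R] j]|[[[i R] k] j]]|] //.
by case: eqP => // h _ [->|->] /=; [move/eqP: h => ->|].
Qed.

Lemma State_opI x y : State (opI x y) = init_st.
Proof. by rewrite /opI; case: ifP => // _; case: ifP. Qed.

Lemma opI_C x y : ~~ inD x -> inY (opI x y) -> inC y /\ opI x y = (init_st, Zero).
Proof. by rewrite /opI => /negPf ->; case: ifP. Qed.

Lemma opI_nD x y : ~~ inD x -> ~~ inD (opI x y).
Proof. by rewrite /opI => /negPf ->; case: ifP. Qed.

Lemma State_opH x : State (opH x) = halt_st.
Proof. by rewrite /opH; case: ifP. Qed.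

Lemma opH_Y x : inY (opH x) ->
  (x = (halt_st, Zero) \/ x = (halt_st, Dot)) /\ opH x = (halt_st, Zero).
Proof. by rewrite /opH; case: orP => [[/eqP ->|/eqP ->]|//] _; split=> //; auto. Qed.

Lemma opH_nD x : ~~ inD (opH x).
Proof. by rewrite /opH; case: ifP. Qed.

Lemma State_opN0 x y z : State (opN0 x y z) = State (meet y z).
Proof.
rewrite /opN0; case: ifP => [/andP [_ /eqP e]|_]; first by rewrite State_meet e; case: ifP.
case: ifP => // /and3P [_ _ /eqP e]; by rewrite State_meet e; case: ifP.
Qed.

Lemma opN0_Y x y z : inY (opN0 x y z) -> State y = State z /\
  ((x = (halt_st, Dot) /\ opN0 x y z = y) \/
   [/\ x = (halt_st, Zero), ~~ inD z & opN0 x y z = z]).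
Proof.
rewrite /opN0; case: (x =P (halt_st, Dot)) => [->|_] /=.
  by case: ifP => [/eqP e _|//]; split=> //; left.
by case: and3P => [[/eqP -> h /eqP e] _|//]; split=> //; right.
Qed.

Lemma opN0_zero y z : State y = State z -> ~~ inD z ->
  opN0 (halt_st, Zero) y z = z.
Proof. by rewrite /opN0 => -> ->; rewrite !eqxx. Qed.

Lemma opN0_dot y z : State y = State z -> opN0 (halt_st, Dot) y z = y.
Proof. by rewrite /opN0 => ->; rewrite !eqxx. Qed.

Lemma opN0_nD x y z : ~~ inD x -> ~~ inD (opN0 x y z).
Proof.
move=> hx; case: (boolP (inY (opN0 x y z))) => [h|]; last first.
  by rewrite /inY negbK /inX /inD => /eqP ->.
have [_ [[e _]|[_ hz ->]] //] := opN0_Y h.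
by rewrite e in hx.
Qed.

Lemma State_opS x y z : State (opS x y z) = init_st.
Proof. by rewrite /opS; case: ifP. Qed.

Lemma opS_Y x y z : inY (opS x y z) ->
  x = (init_st, Zero) /\ opS x y z = (init_st, Zero).
Proof. by rewrite /opS; case: ifP => // /and4P [/eqP -> ]. Qed.

Lemma opS_C x y z : ~~ inD y -> ~~ inD z -> inY (opS x y z) ->
  [/\ y = (init_st, Zero) & z = (init_st, Zero)].
Proof.
rewrite /opS; case: ifP => // /and4P [_].
case: y => s c; case: z => t d /= /eqP -> /eqP ->.
by case: c => [|||[]]; case: d => [|||[]].
Qed.

Lemma opS_nD x y z : ~~ inD (opS x y z).
Proof. by rewrite /opS; case: ifP. Qed.

Lemma State_opNdot u x y z : State (opNdot u x y z) = State (meet (meet x y) z).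
Proof.
rewrite /opNdot; case: (boolP ((State x == State y) && (State y == State z))) => //=.
case/andP=> /eqP exy /eqP eyz.
have -> : State (meet (meet x y) z) = State z by rewrite !State_meet exy eyz !if_same.
do 4 ?[case: (X in if X then _ else _)]; rewrite ?exy ?eyz //.
by rewrite /toX /State /= -/(State _) !State_meet exy eyz !if_same.
Qed.

(** Even the case that returns [z] does so only when [z] is [x] or [y]. *)
Lemma opNdot_Y u x y z : inY (opNdot u x y z) ->
  opNdot u x y z = x \/ opNdot u x y z = y.
Proof.
rewrite /opNdot; case: (X in if X then _ else _); first by auto.
case: (X in if X then _ else _); first by auto.
case: (X in if X then _ else _); first by auto.
by case: and3P => // -[_ _ /orP [/eqP ->|/eqP ->]]; auto.
Qed.

Lemma opNdot_C u x y z : ~~ inD u -> inY (opNdot u x y z) ->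
  [/\ x = y, State y = State z & opNdot u x y z = x].
Proof.
rewrite /opNdot => /negPf ->; rewrite !andbF.
by case: and3P => // -[/andP [_ /eqP ?] /eqP ? _].
Qed.

Lemma opNdot_diag u x z : inY x -> State x = State z -> opNdot u x x z = x.
Proof. by rewrite /opNdot /inY => -> ->; rewrite !eqxx. Qed.

Lemma opNdot_nD u x y z : ~~ inD u -> ~~ inD x -> ~~ inD (opNdot u x y z).
Proof.
move=> hu hx; case: (boolP (inY (opNdot u x y z))) => [h|]; last first.
  by rewrite /inY negbK /inX /inD => /eqP ->.
by have [_ _ ->] := opNdot_C hu h.
Qed.

End Pointwise.

(** * Subuniverses *)

Section Subuniverses.
Variables (n : nat) (M : machine n).

Record stable (I : finType) (S : {set power I n}) : Prop := Stable {
  stable_meet : forall a b, a \in S -> b \in S -> lift2 (@meet n) a b \in S;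
  stable_M : forall a b, a \in S -> b \in S -> lift2 (opM M) a b \in S;
  stable_M' : forall a, a \in S -> lift1 (opM' M) a \in S;
  stable_I : forall a b, a \in S -> b \in S -> lift2 (@opI n) a b \in S;
  stable_H : forall a, a \in S -> lift1 (@opH n) a \in S;
  stable_N0 : forall a b c, a \in S -> b \in S -> c \in S ->
    lift3 (@opN0 n) a b c \in S;
  stable_S : forall a b c, a \in S -> b \in S -> c \in S ->
    lift3 (@opS n) a b c \in S;
  stable_Ndot : forall a b c d, a \in S -> b \in S -> c \in S -> d \in S ->
    lift4 (@opNdot n) a b c d \in S;
  stable_P : forall a b c d, a \in S -> b \in S -> c \in S -> d \in S ->
    lift4 (@opP n) a b c d \in S }.

Variable I : finType.
Implicit Types (R S G : {set power I n}).

Lemma closed1P F S :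
  reflect (forall a, a \in S -> lift1 F a \in S) (closed1 F S).
Proof. exact: 'forall_in_idP. Qed.

Lemma closed2P F S :
  reflect (forall a b, a \in S -> b \in S -> lift2 F a b \in S) (closed2 F S).
Proof.
apply: (iffP 'forall_in_'forall_in_idP) => h; first by move=> a b ha; apply: h.
by move=> a ha b; apply: h.
Qed.

Lemma closed3P F S :
  reflect (forall a b c, a \in S -> b \in S -> c \in S -> lift3 F a b c \in S)
    (closed3 F S).
Proof.
apply: (iffP 'forall_in_'forall_in_'forall_in_idP) => h.
  by move=> a b c ha hb; apply: h.
by move=> a ha b hb c; apply: h.
Qed.

Lemma closed4P F S :
  reflect (forall a b c d, a \in S -> b \in S -> c \in S -> d \in S ->
    lift4 F a b c d \in S) (closed4 F S).
Proof.
apply: (iffP 'forall_in_'forall_in_'forall_in_'forall_in_idP) => h.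
  by move=> a b c d ha hb hc; apply: h.
by move=> a ha b hb c hc d; apply: h.
Qed.

Lemma subuniverseP S : reflect (stable S) (subuniverse M S).
Proof.
apply: (iffP idP) => [|[h1 h2 h3 h4 h5 h6 h7 h8 h9]].
  case/and5P=> /closed2P h1 /closed2P h2 /closed1P h3 /closed2P h4.
  by case/and5P=> /closed1P h5 /closed3P h6 /closed3P h7 /closed4P h8 /closed4P h9.
apply/and5P; split; [exact/closed2P|exact/closed2P|exact/closed1P|exact/closed2P|].
by apply/and5P; split; [exact/closed1P|exact/closed3P|exact/closed3P|exact/closed4P|exact/closed4P].
Qed.

Lemma sub_Sg G : G \subset Sg M G.
Proof. by apply/bigcapsP => S /andP []. Qed.

Lemma Sg_min G S : stable S -> G \subset S -> Sg M G \subset S.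
Proof. by move=> /subuniverseP hS hG; apply: bigcap_inf; rewrite hS. Qed.

Lemma Sg_stable G : stable (Sg M G).
Proof.
have sub S : subuniverse M S && (G \subset S) -> {subset Sg M G <= S}.
  by move=> hS; apply/subsetP; apply: bigcap_inf.
split=> *; apply/bigcapP => S hS; have /andP [/subuniverseP [] *] := hS; have := sub S hS.
all: by rewrite /sub_mem; auto.
Qed.

End Subuniverses.

(** * Transport of preservation to relations indexed by any finite type *)

Section Reindexing.
Variables (n : nat) (M : machine n).

Lemma stable_preim (I J : finType) (h : I -> J) (S : {set power I n}) :
  stable M S -> stable M [set x : power J n | [ffun i => x (h i)] \in S].
Proof.
have e1 F (a : power J n) :
    [ffun i => lift1 F a (h i)] = lift1 F [ffun i => a (h i)].
  by apply/ffunP => i; rewrite !ffunE.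
have e2 F (a b : power J n) :
    [ffun i => lift2 F a b (h i)] = lift2 F [ffun i => a (h i)] [ffun i => b (h i)].
  by apply/ffunP => i; rewrite !ffunE.
have e3 F (a b c : power J n) :
    [ffun i => lift3 F a b c (h i)] =
    lift3 F [ffun i => a (h i)] [ffun i => b (h i)] [ffun i => c (h i)].
  by apply/ffunP => i; rewrite !ffunE.
have e4 F (a b c d : power J n) :
    [ffun i => lift4 F a b c d (h i)] =
    lift4 F [ffun i => a (h i)] [ffun i => b (h i)] [ffun i => c (h i)]
      [ffun i => d (h i)].
  by apply/ffunP => i; rewrite !ffunE.
case=> h1 h2 h3 h4 h5 h6 h7 h8 h9.
by split=> [a b|a b|a|a b|a|a b c|a b c|a b c d|a b c d]; rewrite !inE ?e1 ?e2 ?e3 ?e4; auto.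
Qed.

Lemma preserves_finType (k m : nat) (f : {ffun 'I_k -> elt n} -> elt n) :
  (forall (p : nat) (S : {set power 'I_p n}),
     p < m -> subuniverse M S -> preserves f S) ->
  forall (I : finType) (S : {set power I n}),
    #|I| < m -> stable M S -> preserves f S.
Proof.
move=> hf I S hI hS g hg.
pose S' := [set x : power 'I_#|I| n | [ffun i => x (enum_rank i)] \in S].
have hS' : subuniverse M S' by apply/subuniverseP; apply: stable_preim.
have e (x : power I n) : [ffun i => [ffun j => x (enum_val j)] (enum_rank i)] = x.
  by apply/ffunP => i; rewrite !ffunE enum_rankK.
have: apply_op f (fun l => [ffun j => g l (enum_val j)]) \in S'.
  by apply: (hf _ S' hI hS') => l; rewrite inE e hg.
rewrite inE (_ : [ffun i => _] = apply_op f g) //.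
apply/ffunP => i; rewrite !ffunE; congr f.
by apply/ffunP => l; rewrite !ffunE enum_rankK.
Qed.

End Reindexing.

(** * Graphs of content selections *)

(** [Zero] is allowed as a value because [opI], [opH] and [opS] reset contents to it and [opM']
    never destroys it. *)
Definition selective (J : finType) (F : {ffun J -> content} -> content) : Prop :=
  forall c, F c = Zero \/ exists j, F c = c j.

Lemma selective_zero (J : finType) (F : {ffun J -> content} -> content)
    (c : {ffun J -> content}) :
  selective F -> (forall j, c j = Zero) -> F c = Zero.
Proof. by move=> hF hc; case: (hF c) => [//|[j ->]]. Qed.

Section Graph.
Variables (n : nat) (M : machine n) (J : finType) (j0 : J).
Variable F : {ffun J -> content} -> content.
Hypothesis hF : selective F.
Implicit Types x a b c d : power (option J) n.

Definition contents x : {ffun J -> content} := [ffun j => Content (x (Some j))].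

(** The value at [None] is prescribed only if all other entries are outside [X]: two tuples may
    differ at some [Some j] and agree at [None], and their meet is then in [X] only at the
    former. *)
Definition graph : {set power (option J) n} :=
  [set x : power (option J) n |
    [&& [forall j, State (x (Some j)) == State (x None)],
        [forall o, ~~ inD (x o)] &
        [forall j, inY (x (Some j))] ==> (Content (x None) == F (contents x))]].

Lemma graphP x : reflect
  [/\ forall j, State (x (Some j)) = State (x None), forall o, ~~ inD (x o) &
      (forall j, inY (x (Some j))) -> Content (x None) = F (contents x)]
  (x \in graph).
Proof.
rewrite inE; apply: (iffP and3P) => -[h1 h2 h3].
  split; [by move=> j; apply/eqP/(forallP h1)|exact/forallP|].
  by move=> hY; apply/eqP/(implyP h3)/forallP.
split; [by apply/forallP => j; apply/eqP|exact/forallP|].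
by apply/implyP => /forallP hY; apply/eqP/h3.
Qed.

Lemma graph_None_Y x : x \in graph -> (forall j, inY (x (Some j))) -> inY (x None).
Proof.
move=> /graphP [_ _ h] hY; rewrite /inY /inX h //.
by case: (hF (contents x)) => [->//|[j ->]]; rewrite ffunE; apply: hY.
Qed.

Lemma graph_None_eq x y : x \in graph -> y \in graph ->
  (forall j, x (Some j) = y (Some j)) -> (forall j, inY (x (Some j))) ->
  x None = y None.
Proof.
move=> /graphP [sx _ hx] /graphP [sy _ hy] e hY; apply: elt_eq.
  by rewrite -(sx j0) -(sy j0) e.
rewrite hx // hy => [|j]; last by rewrite -e.
by congr F; apply/ffunP => j; rewrite !ffunE e.
Qed.

Lemma graph_None_zero x s : x \in graph ->
  (forall j, x (Some j) = (s, Zero)) -> x None = (s, Zero).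
Proof.
move=> /graphP [sx _ hx] e; apply: elt_eq; first by rewrite -(sx j0) e.
rewrite hx => [|j]; last by rewrite e.
by apply: selective_zero => // j; rewrite ffunE e.
Qed.

(** In the absence of dots, a value outside [X] forces the arguments to agree, or is a reset to
    [Zero], or copies a single argument. In each case the value at [None] follows the selection
    [F]. *)
Lemma graph_stable : stable M graph.
Proof.
split.
- move=> a b ha hb; have [sa da _] := graphP _ ha; have [sb db _] := graphP _ hb.
  apply/graphP; split=> [j|o|hY]; rewrite ?ffunE.
  + by rewrite !State_meet sa sb.
  + by rewrite /meet; case: ifP.
  have e j : a (Some j) = b (Some j) by apply: meet_Y; have := hY j; rewrite ffunE.
  have aY j : inY (a (Some j)) by have := hY j; rewrite ffunE -e meetxx.
  rewrite -(graph_None_eq ha hb) // meetxx; have [_ _ ->//] := graphP _ ha.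
  by congr F; apply/ffunP => j; rewrite !ffunE -e meetxx.
- move=> a b ha hb; have [sa da _] := graphP _ ha; have [sb db cb] := graphP _ hb.
  apply/graphP; split=> [j|o|hY]; rewrite ?ffunE.
  + by rewrite !State_opM sa sb.
  + exact: opM_nD.
  have hY' j : inY (opM M (a (Some j)) (b (Some j))) by have := hY j; rewrite ffunE.
  have h j := opM_C (da (Some j)) (db (Some j)) (hY' j).
  have e j : a (Some j) = b (Some j) by case: (h j).
  have bY j : inY (b (Some j)) by case: (opM_Y (hY' j)).
  rewrite (graph_None_eq ha hb) //; last by move=> j; rewrite e.
  (* The coordinate [j0] shows that the common state has an instruction. *)
  rewrite (@opM_diag _ _ (b (Some j0))) ?sb //; last by have := hY' j0; rewrite e.
  by rewrite cb //; congr F; apply/ffunP => j; rewrite !ffunE; case: (h j) => _ ->.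
- move=> a ha; have [sa da ca] := graphP _ ha.
  apply/graphP; split=> [j|o|hY]; rewrite ?ffunE.
  + by rewrite !State_opM' sa.
  + exact: opM'_nD.
  have hY' j : inY (opM' M (a (Some j))) by have := hY j; rewrite ffunE.
  have e j := opM'_Y (hY' j).
  have aY j : inY (a (Some j)) by rewrite /inY /inX -e; apply: hY'.
  have -> : contents (lift1 (opM' M) a) = contents a.
    by apply/ffunP => j; rewrite !ffunE e.
  (* The content at [None] is [Zero] or occurs at some [Some j], where [opM'] is known to keep
     it. *)
  rewrite -ca //; have := ca aY; case: (hF (contents a)) => [->|[j ->]].
    by move=> h; apply: (@opM'_diag _ _ (a (Some j0))) => //; right.
  by rewrite ffunE => h; apply: (@opM'_diag _ _ (a (Some j))) => //; left.
- move=> a b ha hb; have [sa da _] := graphP _ ha; have [sb db _] := graphP _ hb.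
  apply/graphP; split=> [j|o|hY]; rewrite ?ffunE.
  + by rewrite !State_opI.
  + exact: opI_nD.
  have h j : inC (b (Some j)) /\ opI (a (Some j)) (b (Some j)) = (init_st, Zero).
    by apply: opI_C => //; have := hY j; rewrite ffunE.
  rewrite selective_zero // => [|j]; last by rewrite !ffunE; case: (h j) => _ ->.
  have bY : inY (b None).
    by apply: graph_None_Y => // j; case: (h j) => /andP [].
  by rewrite /opI (negPf (da _)) /inC db andbT -/(inY _) bY.
- move=> a ha; have [sa da _] := graphP _ ha.
  apply/graphP; split=> [j|o|hY]; rewrite ?ffunE.
  + by rewrite !State_opH.
  + exact: opH_nD.
  have e j : a (Some j) = (halt_st, Zero).
    have : inY (opH (a (Some j))) by have := hY j; rewrite ffunE.
    by case/opH_Y => -[//|h] _; have := da (Some j); rewrite h.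
  rewrite (graph_None_zero ha e) selective_zero // => j.
  by rewrite !ffunE e.
- move=> a b c ha hb hc; have [sa da _] := graphP _ ha.
  have [sb db _] := graphP _ hb; have [sc dc cc] := graphP _ hc.
  apply/graphP; split=> [j|o|hY]; rewrite ?ffunE.
  + by rewrite !State_opN0 !State_meet sb sc.
  + exact: opN0_nD.
  have h j : [/\ State (b (Some j)) = State (c (Some j)), a (Some j) = (halt_st, Zero) &
      opN0 (a (Some j)) (b (Some j)) (c (Some j)) = c (Some j)].
    have : inY (opN0 (a (Some j)) (b (Some j)) (c (Some j))).
      by have := hY j; rewrite ffunE.
    case/opN0_Y => hs [[e _]|[e _ e']]; last by split.
    by have := da (Some j); rewrite e.
  rewrite (graph_None_zero (s := halt_st) ha) => [|j]; last by case: (h j).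
  rewrite opN0_zero //; last by case: (h j0); rewrite sb sc.
  rewrite cc => [|j].
    by congr F; apply/ffunP => j; rewrite !ffunE; case: (h j) => _ _ ->.
  by have := hY j; rewrite ffunE; case: (h j) => _ _ ->.
- move=> a b c ha hb hc; have [_ db _] := graphP _ hb; have [_ dc _] := graphP _ hc.
  apply/graphP; split=> [j|o|hY]; rewrite ?ffunE.
  + by rewrite !State_opS.
  + exact: opS_nD.
  have h j : [/\ a (Some j) = (init_st, Zero), b (Some j) = (init_st, Zero) &
      c (Some j) = (init_st, Zero)].
    have hY' : inY (opS (a (Some j)) (b (Some j)) (c (Some j))).
      by have := hY j; rewrite ffunE.
    by have [-> ->] := opS_C (db _) (dc _) hY'; have [-> _] := opS_Y hY'.
  rewrite (graph_None_zero (s := init_st) ha) => [|j]; last by case: (h j).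
  rewrite (graph_None_zero (s := init_st) hb) => [|j]; last by case: (h j).
  rewrite (graph_None_zero (s := init_st) hc) => [|j]; last by case: (h j).
  rewrite selective_zero // => j; rewrite !ffunE; case: (h j) => -> -> ->.
  by [].
- move=> a b c d ha hb hc hd; have [sa da _] := graphP _ ha.
  have [sb db cb] := graphP _ hb; have [sc dc _] := graphP _ hc.
  have [sd dd _] := graphP _ hd.
  apply/graphP; split=> [j|o|hY]; rewrite ?ffunE.
  + by rewrite !State_opNdot !State_meet sb sc sd.
  + exact: opNdot_nD.
  have hY' j : inY (opNdot (a (Some j)) (b (Some j)) (c (Some j)) (d (Some j))).
    by have := hY j; rewrite ffunE.
  have h j := opNdot_C (da (Some j)) (hY' j).
  have bY j : inY (b (Some j)) by have := hY' j; case: (h j) => _ _ ->.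
  rewrite -(graph_None_eq hb hc) // => [|j]; last by case: (h j).
  rewrite opNdot_diag; first 1 last.
  + exact: graph_None_Y.
  + by rewrite -(sb j0) -(sd j0); case: (h j0) => <-.
  rewrite cb //; congr F; apply/ffunP => j; rewrite !ffunE.
  by case: (h j) => _ _ ->.
- move=> a b c d ha hb hc hd; have [sa _ _] := graphP _ ha; have [sb _ _] := graphP _ hb.
  have s (x : power (option J) n) o :
      (forall j, State (x (Some j)) = State (x None)) -> State (x o) = State (x None).
    by case: o.
  (* By synchronization the test of [opP] has the same outcome at every coordinate, so one whole
     tuple is returned. *)
  rewrite (_ : lift4 _ _ _ _ _ = if State (a None) == State (b None) then c else d).
    by case: ifP.
  apply/ffunP => o; rewrite ffunE /opP (s a) // (s b) //; by case: ifP.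
Qed.

End Graph.

(** * Fusing dot-free coordinates *)

Section Merging.
Variables (n : nat) (M : machine n) (I J : finType) (j0 : J) (iota : J -> I).
Variables (G R : {set power I n}).
Hypotheses (hR : stable M R) (hcomp : computational R) (hGR : G \subset R).
Hypothesis hdotfree : forall r j, r \in R -> ~~ inD (r (iota j)).

Variables (F : bool -> {ffun J -> content} -> content) (vals : seq content).
Hypotheses (hF : forall b, selective (F b)) (h0 : Zero \in vals).
(** This is what makes the two new rows recognise a constant column: they agree on a value of [vals]
    only if the whole column has that value. *)
Hypothesis hFinj : forall c : {ffun J -> content},
  F true c = F false c -> F true c \in vals -> forall j, c j = F true c.

Notation rest := {i | i \notin codom iota}.
Notation merged := (rest + bool)%type.
Implicit Types (r : power I n) (d u x y z : power merged n) (K : {set rest}).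

Definition fuse_row (b : bool) r : elt n :=
  (State (r (iota j0)),
   if [forall j, inY (r (iota j))] then F b [ffun j => Content (r (iota j))]
   else Cross).

Definition fuse r : power merged n :=
  [ffun t => match t with inl o => r (val o) | inr b => fuse_row b r end].

(** The tuple [r] is exact on all of [rest], even where [d] is in [X], but says nothing of the
    contents of the new rows. It supplies the values of arguments that are read at a single
    coordinate or only at their dots. *)
Definition based d r : bool :=
  [forall o, d (inl o) == r (val o)] &&
  [forall b, (State (d (inr b)) == State (r (iota j0))) && ~~ inD (d (inr b))].

(* A tuple [d] of the fused relation, outside [X] off [K], is compared with a
   tuple [r] of [R]: [shadows] only records membership in [X] and [D], which is
   all that [I] reads, while [lifts] recovers the values. *)
Definition clean K d : bool :=
  [forall o, (o \notin K) ==> inY (d (inl o))] && [forall b, inY (d (inr b))].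

Definition shadows K d r : bool :=
  [forall o, (o \notin K) ==>
     inY (r (val o)) && (inD (r (val o)) == inD (d (inl o)))] &&
  [forall j, inY (r (iota j))].

Definition lifts K d r : bool :=
  [forall o, (o \notin K) ==> (r (val o) == d (inl o))] &&
  [forall j, r (iota j) == d (inr true)].

Definition liftable d : bool :=
  (Content (d (inr true)) == Content (d (inr false))) &&
  (Content (d (inr true)) \in vals).

(** A shadow is required even of tuples that are not liftable, since [opI] erases the contents of
    its second argument and makes the result liftable. *)
Definition liftsto K d : bool :=
  [exists r in R, shadows K d r] &&
  (liftable d ==> [exists r in R, lifts K d r]).

(** All sets [K] are considered at once because [opI] and [opN0] require their arguments to be
    outside [X] only off a larger set than their result. *)
Definition inv : {set power merged n} :=
  [set d : power merged n | [exists r in R, based d r] &&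
    [forall K, clean K d ==> liftsto K d]].

Lemma basedP d r : reflect
  ((forall o, d (inl o) = r (val o)) /\
   (forall b, State (d (inr b)) = State (r (iota j0)) /\ ~~ inD (d (inr b))))
  (based d r).
Proof.
apply: (iffP andP) => -[h1 h2]; split.
- by move=> o; apply/eqP/(forallP h1).
- by move=> b; have /andP [/eqP] := forallP h2 b.
- by apply/forallP => o; apply/eqP.
- by apply/forallP => b; have [-> ->] := h2 b; rewrite eqxx.
Qed.

Lemma cleanP K d : reflect
  ((forall o, o \notin K -> inY (d (inl o))) /\ (forall b, inY (d (inr b))))
  (clean K d).
Proof. by apply: (iffP andP) => -[/'forall_implyP h1 /forallP h2]. Qed.

Lemma shadowsP K d r : reflect
  ((forall o, o \notin K -> inY (r (val o)) /\ inD (r (val o)) = inD (d (inl o))) /\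
   (forall j, inY (r (iota j))))
  (shadows K d r).
Proof.
apply: (iffP andP) => -[h1 h2]; split; try exact/forallP.
  by move=> o ho; have /andP [? /eqP] := implyP (forallP h1 o) ho.
by apply/'forall_implyP => o /h1 [-> ->]; rewrite eqxx.
Qed.

Lemma liftsP K d r : reflect
  ((forall o, o \notin K -> r (val o) = d (inl o)) /\
   (forall j, r (iota j) = d (inr true)))
  (lifts K d r).
Proof.
apply: (iffP andP) => -[h1 h2]; split.
- by move=> o ho; apply/eqP/(implyP (forallP h1 o)).
- by move=> j; apply/eqP/(forallP h2).
- by apply/'forall_implyP => o /h1 ->.
- by apply/forallP => j; rewrite h2.
Qed.

Lemma invP d : reflect
  ((exists2 r, r \in R & based d r) /\ (forall K, clean K d -> liftsto K d))
  (d \in inv).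
Proof.
rewrite inE; apply: (iffP andP) => -[h1 h2]; split; try exact/exists_inP.
  by move=> K; apply/implyP/(forallP h2).
by apply/'forall_implyP.
Qed.

Lemma sync r i i' : r \in R -> State (r i) = State (r i').
Proof. by case/hcomp. Qed.

Lemma one_dot r i i' : r \in R -> inD (r i) -> inD (r i') -> i = i'.
Proof.
by case/hcomp=> _ /card_le1_eqP h hi hi'; apply: h; rewrite inE.
Qed.

Lemma inv_sync d t t' : d \in inv -> State (d t) = State (d t').
Proof.
case/invP=> -[r hr /basedP [e1 e2]] _.
have s v : State (d v) = State (r (iota j0)).
  by case: v => [o|b]; [rewrite e1; apply: sync|case: (e2 b)].
by rewrite !s.
Qed.

Lemma inv_dotfree d b : d \in inv -> ~~ inD (d (inr b)).
Proof. by case/invP=> -[r hr /basedP [_ /(_ b) []]]. Qed.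

Lemma inv_one_dot d o o' : d \in inv -> inD (d (inl o)) -> inD (d (inl o')) -> o = o'.
Proof.
case/invP=> -[r hr /basedP [e1 _]] _; rewrite !e1 => h h'.
exact/val_inj/(one_dot hr h h').
Qed.

(** A lift of a clean tuple is also a shadow of it, so one witness serves both clauses. *)
Lemma lifts_liftsto K d r : r \in R -> clean K d -> lifts K d r -> liftsto K d.
Proof.
move=> hr /cleanP [h1 h2] hl; have [l1 l2] := liftsP _ _ _ hl.
apply/andP; split; last by apply/implyP => _; apply/exists_inP; exists r.
apply/exists_inP; exists r => //; apply/shadowsP; split=> [o ho|j].
  by rewrite l1 // h1.
by rewrite l2.
Qed.

(** Nothing in [liftsto] depends on the entries in [K]. This settles every operation whose result
    coincides with one of its arguments off [K] and at the new rows. *)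
Lemma eq_liftsto K d x : x \in inv -> clean K d ->
  (forall o, o \notin K -> d (inl o) = x (inl o)) ->
  (forall b, d (inr b) = x (inr b)) -> liftsto K d.
Proof.
case/invP=> _ hx /cleanP [h1 h2] e1 e2.
have /hx : clean K x.
  by apply/cleanP; split=> [o ho|b]; [rewrite -e1 // h1|rewrite -e2].
case/andP=> /exists_inP [r hr /shadowsP [s1 s2]] hl.
apply/andP; split.
  apply/exists_inP; exists r => //; apply/shadowsP; split=> // o ho.
  by rewrite e1 //; apply: s1.
apply/implyP; rewrite /liftable !e2 => /(implyP hl) /exists_inP [r' hr' /liftsP [l1 l2]].
apply/exists_inP; exists r' => //; apply/liftsP; split=> [o ho|j].
  by rewrite e1 // l1.
by rewrite e2.
Qed.

(** * Closure of the invariant under the nine operations *)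

Lemma meet_inv x y : x \in inv -> y \in inv -> lift2 (@meet n) x y \in inv.
Proof.
move=> hx hy; apply/invP; split.
  have [[r hr /basedP [e1 e2]] _] := invP _ hx.
  have [[r' hr' /basedP [e1' e2']] _] := invP _ hy.
  exists (lift2 (@meet n) r r'); first exact: (stable_meet hR).
  apply/basedP; split=> [o|b]; rewrite !ffunE ?e1 ?e1' //.
  have [s _] := e2 b; have [s' _] := e2' b; rewrite !State_meet s s'; split=> //.
  by rewrite /meet; case: ifP => // _; apply: inv_dotfree.
move=> K hK; have [h1 h2] := cleanP _ _ hK.
apply: (eq_liftsto hx) => // [o /h1|b].
  by rewrite ffunE => /meet_Y ->; rewrite meetxx.
by have := h2 b; rewrite ffunE => /meet_Y ->; rewrite meetxx.
Qed.

Lemma M_inv x y : x \in inv -> y \in inv -> lift2 (opM M) x y \in inv.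
Proof.
move=> hx hy; have [[rx hrx /basedP [e1 e2]] hx'] := invP _ hx.
have [[ry hry /basedP [e1' e2']] hy'] := invP _ hy.
apply/invP; split.
  exists (lift2 (opM M) rx ry); first exact: (stable_M hR).
  apply/basedP; split=> [o|b]; rewrite !ffunE ?e1 ?e1' //.
  have [s hd] := e2 b; have [s' hd'] := e2' b; rewrite !State_opM s s'; split=> //.
  exact: opM_nD.
move=> K /cleanP [h1 h2].
have Yl o : o \notin K -> inY (opM M (x (inl o)) (y (inl o))).
  by move/h1; rewrite ffunE.
have Yr b : inY (opM M (x (inr b)) (y (inr b))) by have := h2 b; rewrite ffunE.
have /hx' /andP [_ lx] : clean K x.
  by apply/cleanP; split=> [o /Yl|b]; [|have := Yr b]; case/opM_Y.
have /hy' /andP [/exists_inP [r hr /shadowsP [s1 s2]] ly] : clean K y.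
  by apply/cleanP; split=> [o /Yl|b]; [|have := Yr b]; case/opM_Y.
apply/andP; split.
  (* A shadow of [y] is one of the result, as dots come from the second argument. *)
  apply/exists_inP; exists r => //; apply/shadowsP; split=> // o ho.
  by have [-> ->] := s1 o ho; rewrite ffunE; have [_ _ _ ->] := opM_Y (Yl o ho).
(* At the new rows both arguments coincide and their content is kept, so liftability of the result
   passes back to [x] and [y]. *)
have C b := opM_C (inv_dotfree b hx) (inv_dotfree b hy) (Yr b).
apply/implyP; rewrite /liftable !ffunE.
have [_ ->] := C true; have [_ ->] := C false => hl.
have /(implyP lx) /exists_inP [r1 hr1 /liftsP [l1 l2]] : liftable x.
  by rewrite /liftable; have [-> _] := C true; have [-> _] := C false.
have /exists_inP [r2 hr2 /liftsP [l1' l2']] := implyP ly hl.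
apply/exists_inP; exists (lift2 (opM M) r1 r2); first exact: (stable_M hR).
by apply/liftsP; split=> [o ho|j]; rewrite !ffunE ?l1 ?l1' ?l2 ?l2'.
Qed.

Lemma M'_inv x : x \in inv -> lift1 (opM' M) x \in inv.
Proof.
move=> hx; have [[rx hrx /basedP [e1 e2]] hx'] := invP _ hx.
apply/invP; split.
  exists (lift1 (opM' M) rx); first exact: (stable_M' hR).
  apply/basedP; split=> [o|b]; rewrite !ffunE ?e1 //.
  by have [s hd] := e2 b; rewrite !State_opM' s; split=> //; apply: opM'_nD.
move=> K /cleanP [h1 h2].
have Yl o : o \notin K -> Content (opM' M (x (inl o))) = Content (x (inl o)).
  by move/h1; rewrite ffunE => /opM'_Y.
have Yr b : Content (opM' M (x (inr b))) = Content (x (inr b)).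
  by have := h2 b; rewrite ffunE => /opM'_Y.
have /hx' /andP [/exists_inP [r hr /shadowsP [s1 s2]] lx] : clean K x.
  apply/cleanP; split=> [o ho|b]; rewrite /inY /inX.
    by rewrite -Yl //; have := h1 o ho; rewrite ffunE.
  by rewrite -Yr; have := h2 b; rewrite ffunE.
apply/andP; split.
  apply/exists_inP; exists r => //; apply/shadowsP; split=> // o ho.
  by have [-> ->] := s1 o ho; rewrite ffunE /inD Yl.
apply/implyP; rewrite /liftable !ffunE !Yr => /(implyP lx) /exists_inP [r1 hr1 /liftsP [l1 l2]].
apply/exists_inP; exists (lift1 (opM' M) r1); first exact: (stable_M' hR).
by apply/liftsP; split=> [o ho|j]; rewrite !ffunE ?l1 ?l2.
Qed.

Lemma I_inv x y : x \in inv -> y \in inv -> lift2 (@opI n) x y \in inv.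
Proof.
move=> hx hy; have [[rx hrx /basedP [e1 e2]] hx'] := invP _ hx.
have [[ry hry /basedP [e1' e2']] hy'] := invP _ hy.
apply/invP; split.
  exists (lift2 (@opI n) rx ry); first exact: (stable_I hR).
  apply/basedP; split=> [o|b]; rewrite !ffunE ?e1 ?e1' //.
  by rewrite !State_opI; split=> //; apply/opI_nD/inv_dotfree.
move=> K hK; have [h1 h2] := cleanP _ _ hK.
(* At a dot of [x] the result is a dot whatever [y] is, so nothing is known of [y] there. *)
pose K' := [set o | (o \in K) || inD (x (inl o))].
have Cl o : o \notin K' -> inC (y (inl o)).
  rewrite inE negb_or => /andP [/h1]; rewrite ffunE => ho hd.
  by case: (opI_C hd ho).
have Cr b : inC (y (inr b)) /\ opI (x (inr b)) (y (inr b)) = (init_st, Zero).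
  by apply: opI_C; [exact: inv_dotfree|have := h2 b; rewrite ffunE].
have /hy' /andP [/exists_inP [r hr /shadowsP [s1 s2]] _] : clean K' y.
  by apply/cleanP; split=> [o /Cl|b]; [|have [+ _] := Cr b]; case/andP.
(* The base of [x] has the right dots and a shadow of [y] is in [C] where needed, which is all that
   [opI] reads. *)
apply: (@lifts_liftsto _ _ (lift2 (@opI n) rx r)) => //; first exact: (stable_I hR).
apply/liftsP; split=> [o ho|j]; rewrite !ffunE.
  rewrite -e1 /opI; case: ifP => // hd.
  have ho' : o \notin K' by rewrite inE (negPf ho) hd.
  have [yY yD] := s1 o ho'; have := Cl o ho'; rewrite /inC => /andP [-> ->].
  by rewrite -/(inY _) yY yD; have := Cl o ho' => /andP [_ ->].
have [_ ->] := Cr true.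
by rewrite /opI /inC (negPf (hdotfree _ hrx)) (hdotfree _ hr) -/(inY _) s2.
Qed.

Lemma H_inv x : x \in inv -> lift1 (@opH n) x \in inv.
Proof.
move=> hx; have [[rx hrx /basedP [e1 e2]] hx'] := invP _ hx.
apply/invP; split.
  exists (lift1 (@opH n) rx); first exact: (stable_H hR).
  apply/basedP; split=> [o|b]; rewrite !ffunE ?e1 //.
  by rewrite !State_opH; split=> //; apply: opH_nD.
move=> K hK; have [h1 h2] := cleanP _ _ hK.
have er b : x (inr b) = (halt_st, Zero).
  have := h2 b; rewrite ffunE => /opH_Y [[//|e] _].
  by have := inv_dotfree b hx; rewrite e.
have /hx' /andP [_ /implyP lx] : clean K x.
  apply/cleanP; split=> [o /h1|b]; last by rewrite er.
  by rewrite ffunE => /opH_Y [[->|->] _].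
(* The new rows of [x] are both [Zero], a member of [vals]. *)
have /lx /exists_inP [r hr /liftsP [l1 l2]] : liftable x by rewrite /liftable !er h0 eqxx.
apply: (@lifts_liftsto _ _ (lift1 (@opH n) r)) => //; first exact: (stable_H hR).
by apply/liftsP; split=> [o ho|j]; rewrite !ffunE ?l1 ?l2.
Qed.

Lemma N0_inv x y z : x \in inv -> y \in inv -> z \in inv ->
  lift3 (@opN0 n) x y z \in inv.
Proof.
move=> hx hy hz; have [[rx hrx /basedP [e1 e2]] hx'] := invP _ hx.
have [[ry hry /basedP [e1' e2']] _] := invP _ hy.
have [[rz hrz /basedP [e1'' e2'']] hz'] := invP _ hz.
apply/invP; split.
  exists (lift3 (@opN0 n) rx ry rz); first exact: (stable_N0 hR).
  apply/basedP; split=> [o|b]; rewrite !ffunE ?e1 ?e1' ?e1'' //.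
  have [s' _] := e2' b; have [s'' _] := e2'' b.
  rewrite !State_opN0 !State_meet s' s''; split=> //.
  exact/opN0_nD/inv_dotfree.
move=> K hK; have [h1 h2] := cleanP _ _ hK.
have Nl o : o \notin K -> State (y (inl o)) = State (z (inl o)) /\
    ((x (inl o) = (halt_st, Dot) /\ opN0 (x (inl o)) (y (inl o)) (z (inl o)) = y (inl o)) \/
     [/\ x (inl o) = (halt_st, Zero), ~~ inD (z (inl o)) &
         opN0 (x (inl o)) (y (inl o)) (z (inl o)) = z (inl o)]).
  by move/h1; rewrite ffunE => /opN0_Y.
have Nr b : [/\ x (inr b) = (halt_st, Zero), inY (z (inr b)) &
    opN0 (x (inr b)) (y (inr b)) (z (inr b)) = z (inr b)].
  have := h2 b; rewrite ffunE => Nb; have := Nb.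
  case/opN0_Y => _ [[e _]|[e _ e']]; last by split; rewrite // -e'.
  by have := inv_dotfree b hx; rewrite e.
(* Without a dot of [x] off [K] the result is [z] there. Otherwise the dot is at a single [o], and
   the result is [y] at [o] and [z] elsewhere off [K]. *)
case: (boolP [exists o, (o \notin K) && inD (x (inl o))]) => [/existsP [o /andP [ho od]]|hnone]; last first.
  apply: (eq_liftsto hz) => // [o ho|b]; rewrite ffunE; last by case: (Nr b).
  have [_ [[e _]|[_ _ ->//]]] := Nl o ho.
  by case/negP: hnone; apply/existsP; exists o; rewrite ho e.
have xo : x (inl o) = (halt_st, Dot).
  by have [_ [[//]|[e]]] := Nl o ho; rewrite e in od.
have xo' o' : o' \notin K -> o' != o ->
    [/\ x (inl o') = (halt_st, Zero), ~~ inD (z (inl o')) &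
      opN0 (x (inl o')) (y (inl o')) (z (inl o')) = z (inl o')].
  move=> ho' neq; have [_ [[e _]|//]] := Nl o' ho'.
  have e' : o' = o by apply: (inv_one_dot hx) => //; rewrite e.
  by rewrite e' eqxx in neq.
have /hx' /andP [_ /implyP lx] : clean K x.
  apply/cleanP; split=> [o' ho'|b]; last by have [-> _] := Nr b.
  by have [_ [[-> _]|[-> _]]] := Nl o' ho'.
have /lx /exists_inP [rx1 hrx1 /liftsP [l1 l2]] : liftable x.
  by rewrite /liftable; have [-> _ _] := Nr true; have [-> _ _] := Nr false; rewrite h0 eqxx.
have rx2 j : rx1 (iota j) = (halt_st, Zero) by rewrite l2; case: (Nr true).
apply/andP; split.
  (* Off [K] the result can have a dot only at [o], namely that of [y]. If there is one, [rx1] has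
     the same dots; if not, [opH] removes the dot of [rx1]. *)
  case: (boolP (inD (y (inl o)))) => yd.
    apply/exists_inP; exists rx1 => //; apply/shadowsP; split=> [o' ho'|j]; last by rewrite rx2.
    rewrite l1 // ffunE; case: (eqVneq o' o) => [->|neq].
      by have [s _] := Nl o ho; rewrite xo opN0_dot // yd.
    by have [-> h ->] := xo' o' ho' neq; rewrite (negPf h).
  apply/exists_inP; exists (lift1 (@opH n) rx1); first exact: (stable_H hR).
  apply/shadowsP; split=> [o' ho'|j]; last by rewrite ffunE rx2.
  rewrite !ffunE l1 //; case: (eqVneq o' o) => [->|neq].
    by have [s _] := Nl o ho; rewrite xo opN0_dot // (negPf yd).
  by have [-> h ->] := xo' o' ho' neq; rewrite (negPf h).
(* The value of [z] at [o] is hidden by [y] and may lie in [X]. *)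
have /hz' /andP [_ /implyP lz] : clean (o |: K) z.
  apply/cleanP; split=> [o'|b]; last by case: (Nr b).
  rewrite in_setU1 negb_or => /andP [neq ho']; have [_ _ e] := xo' o' ho' neq.
  by have := h1 o' ho'; rewrite ffunE e.
apply/implyP; rewrite /liftable !ffunE.
have [xt _ ->] := Nr true; have [_ _ ->] := Nr false => /lz /exists_inP [rz1 hrz1 /liftsP [m1 m2]].
(* The second argument matters only at [o], where its base [ry] is exact, so no lift of [y] is
   needed. *)
apply/exists_inP; exists (lift3 (@opN0 n) rx1 ry rz1); first exact: (stable_N0 hR).
apply/liftsP; split=> [o' ho'|j]; rewrite !ffunE.
  case: (eqVneq o' o) => [->|neq]; last by rewrite l1 // m1 ?e1' // in_setU1 negb_or neq.
  rewrite l1 // xo !opN0_dot ?e1' //; first by case: (Nl o ho); rewrite e1'.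
  (* The content of [rz1] at [o] is unknown, but its state is that of the fused coordinates. *)
  rewrite -e1' (sync _ (iota j0) hrz1) m2; case: (Nl o ho) => -> _.
  exact: inv_sync.
rewrite rx2 m2 opN0_zero //; last exact: inv_dotfree.
have [_ _ ->] := Nr true => //.
rewrite (sync _ (iota j0) hry) -(proj1 (e2' true)).
rewrite (inv_sync _ (inl o) hy) (inv_sync _ (inl o) hz).
by case: (Nl o ho).
Qed.

Lemma S_inv x y z : x \in inv -> y \in inv -> z \in inv ->
  lift3 (@opS n) x y z \in inv.
Proof.
move=> hx hy hz; have [[rx hrx /basedP [e1 e2]] _] := invP _ hx.
have [[ry hry /basedP [e1' e2']] _] := invP _ hy.
have [[rz hrz /basedP [e1'' e2'']] _] := invP _ hz.
apply/invP; split.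
  exists (lift3 (@opS n) rx ry rz); first exact: (stable_S hR).
  apply/basedP; split=> [o|b]; rewrite !ffunE ?e1 ?e1' ?e1'' //.
  by rewrite !State_opS; split=> //; apply: opS_nD.
move=> K hK; have [h1 h2] := cleanP _ _ hK.
apply: (eq_liftsto hx) => // [o /h1|b].
  by rewrite ffunE => /opS_Y [-> ->].
by have := h2 b; rewrite ffunE => /opS_Y [-> ->].
Qed.

(** Off [K], the arguments [x] and [y] agree with the result except possibly at the unique dot of
    [u], where the result is one of them. Hence the result is [x] throughout or [y] throughout. *)
Lemma Ndot_inv u x y z : u \in inv -> x \in inv -> y \in inv -> z \in inv ->
  lift4 (@opNdot n) u x y z \in inv.
Proof.
move=> hu hx hy hz; have [[ru hru /basedP [e1 e2]] _] := invP _ hu.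
have [[rx hrx /basedP [e1' e2']] _] := invP _ hx.
have [[ry hry /basedP [e1'' e2'']] _] := invP _ hy.
have [[rz hrz /basedP [f1 f2]] _] := invP _ hz.
apply/invP; split.
  exists (lift4 (@opNdot n) ru rx ry rz); first exact: (stable_Ndot hR).
  apply/basedP; split=> [o|b]; rewrite !ffunE ?e1 ?e1' ?e1'' ?f1 //.
  have [s' _] := e2' b; have [s'' _] := e2'' b; have [t' _] := f2 b.
  rewrite !State_opNdot !State_meet s' s'' t'; split=> //.
  by apply: opNdot_nD; apply: inv_dotfree.
move=> K hK; have [h1 h2] := cleanP _ _ hK.
have Er b : opNdot (u (inr b)) (x (inr b)) (y (inr b)) (z (inr b)) = x (inr b) /\
    x (inr b) = y (inr b).
  have := h2 b; rewrite ffunE => h.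
  by have [? _ ?] := opNdot_C (inv_dotfree b hu) h.
have El o : o \notin K -> ~~ inD (u (inl o)) ->
    opNdot (u (inl o)) (x (inl o)) (y (inl o)) (z (inl o)) = x (inl o) /\
    x (inl o) = y (inl o).
  by move/h1; rewrite ffunE => h hd; have [? _ ?] := opNdot_C hd h.
have [hex|hey] : (forall o, o \notin K ->
      opNdot (u (inl o)) (x (inl o)) (y (inl o)) (z (inl o)) = x (inl o)) \/
    (forall o, o \notin K ->
      opNdot (u (inl o)) (x (inl o)) (y (inl o)) (z (inl o)) = y (inl o)).
- case: (boolP [exists o, (o \notin K) && inD (u (inl o))]) => [/existsP [o /andP [ho od]]|hnone].
    have Eo o' : o' \notin K -> o' != o -> ~~ inD (u (inl o')).
      by move=> _; apply: contra => h; apply/eqP/(inv_one_dot hu).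
    have := h1 o ho; rewrite ffunE => /opNdot_Y [e|e]; [left|right] => o' ho';
      case: (eqVneq o' o) => [->//|neq]; have [e' e''] := El o' ho' (Eo o' ho' neq) => //.
    by rewrite e'.
  left=> o ho; case: (El o ho) => //.
  by apply: contra hnone => h; apply/existsP; exists o; rewrite ho.
- apply: (eq_liftsto hx) => // [o ho|b]; rewrite ffunE ?hex //.
  by case: (Er b).
- apply: (eq_liftsto hy) => // [o ho|b]; rewrite ffunE ?hey //.
  by case: (Er b) => -> ->.
Qed.

Lemma P_inv u x y z : u \in inv -> x \in inv -> y \in inv -> z \in inv ->
  lift4 (@opP n) u x y z \in inv.
Proof.
move=> hu hx hy hz.
rewrite (_ : lift4 _ _ _ _ _ =
    if State (u (inr true)) == State (x (inr true)) then y else z).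
  by case: ifP.
apply/ffunP => t; rewrite ffunE /opP (inv_sync t (inr true) hu).
by rewrite (inv_sync t (inr true) hx); case: ifP.
Qed.

Lemma inv_stable : stable M inv.
Proof.
split; [exact: meet_inv|exact: M_inv|exact: M'_inv|exact: I_inv|exact: H_inv|
  exact: N0_inv|exact: S_inv|exact: Ndot_inv|exact: P_inv].
Qed.

(** * Fused generators and the lifting of generated tuples *)

Lemma fuse_row_dotfree b r : r \in R -> ~~ inD (fuse_row b r).
Proof.
move=> hr; rewrite /fuse_row; case: ifP => // _; rewrite /inD /Content /=.
case: (hF b [ffun j => Content (r (iota j))]) => [->//|[j ->]].
by rewrite ffunE; apply: hdotfree.
Qed.

(** The tuple [r] is its own base, shadow and lift: a new row outside [X] forces all fused entries
    outside [X], and [hFinj] makes a liftable column constant. *)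
Lemma fuse_inv r : r \in R -> fuse r \in inv.
Proof.
move=> hr; have bas : based (fuse r) r.
  apply/basedP; split=> [o|b]; rewrite !ffunE; split=> //.
  exact: fuse_row_dotfree.
apply/invP; split; first by exists r.
move=> K /cleanP [h1 h2].
have hY : forall j, inY (r (iota j)).
  by apply/forallP; have := h2 true; rewrite ffunE /fuse_row; case: ifP.
have e b : fuse r (inr b) = (State (r (iota j0)), F b [ffun j => Content (r (iota j))]).
  by rewrite ffunE /fuse_row; case: forallP.
apply/andP; split.
  apply/exists_inP; exists r => //; apply/shadowsP; split=> // o /h1.
  by rewrite ffunE.
apply/implyP; rewrite /liftable !e => /andP [/eqP hc hv].
apply/exists_inP; exists r => //; apply/liftsP; split=> [o _|j]; first by rewrite ffunE.
rewrite e; apply: elt_eq; first exact: sync.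
by rewrite -(hFinj hc hv j) ffunE.
Qed.

(** The invariant is applied with [K] empty. *)
Lemma Sg_fuse_lift d : d \in Sg M [set fuse r | r in G] ->
  (forall t, inY (d t)) -> liftable d ->
  exists2 r, r \in R & (forall o, r (val o) = d (inl o)) /\
                       (forall j, r (iota j) = d (inr true)).
Proof.
move=> hd hY hl.
have sub : [set fuse r | r in G] \subset inv.
  by apply/subsetP => _ /imsetP [r hr ->]; apply/fuse_inv/(subsetP hGR).
have /invP [_ /(_ set0)] := subsetP (Sg_min inv_stable sub) d hd.
case/(_ _)/andP => [|_ /implyP /(_ hl) /exists_inP [r hr /liftsP [l1 l2]]].
  by apply/cleanP; split.
by exists r => //; split=> // o; apply: l1; rewrite inE.
Qed.

End Merging.

(** * Choice of the coordinates and of the two rows *)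

Lemma card_content : #|{: content}| <= 5.
Proof.
have hreg : #|{: reg}| <= 2 by rewrite -card_bool; apply: leq_card (can_inj bool_of_regK).
by apply: leq_trans (leq_card _ (can_inj content_encK)) _; rewrite !card_option !ltnS.
Qed.

Lemma content_pigeonhole (I : finType) (E : {set I}) (c : I -> content) (k : nat) :
  5 * k < #|E| -> exists a, k < #|[set i in E | c i == a]|.
Proof.
move=> hE; apply/existsP; apply: contraLR hE; rewrite negb_exists -leqNgt => /forallP h.
rewrite -sum1_card (partition_big c predT) //=.
apply: leq_trans (_ : \sum_(a : content) k <= _); last first.
  by rewrite sum_nat_const leq_mul2r card_content orbT.
apply: leq_sum => a _; rewrite sum1dep_card leqNgt.
by have := h a; congr (~~ (_ < _)); apply: eq_card => i; rewrite !inE.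
Qed.

(** * Two selections that together detect constant columns *)

Section Rows.
Variables (J : finType) (a : content).

Definition all_or_zero (c : {ffun J -> content}) : content :=
  if [forall j, c j == a] then a else Zero.

Definition first_nonzero (c : {ffun J -> content}) : content :=
  if [pick j | c j != Zero] is Some j then c j else Zero.

Definition row (b : bool) := if b then all_or_zero else first_nonzero.

Lemma row_selective (j0 : J) b : selective (row b).
Proof.
case: b => c /=; rewrite /all_or_zero /first_nonzero.
  by case: forallP => [h|]; [right; exists j0; rewrite (eqP (h j0))|left].
by case: pickP => [j _|]; [right; exists j|left].
Qed.

(** If not all entries are [a], the first row is [Zero]; the second row is then also [Zero], so the
    column has no nonzero entry. *)
Lemma row_inj c : row true c = row false c -> row true c \in [:: Zero; a] ->
  forall j, c j = row true c.
Proof.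
rewrite /= /all_or_zero; case: forallP => [h _ _ j|_]; first exact/eqP.
rewrite /first_nonzero; case: pickP => [j /eqP h e|h _ _ j]; first by case: h.
by apply/eqP; have /negbFE := h j.
Qed.

Lemma row_const (j0 : J) b : row b [ffun=> a] = a.
Proof.
case: b; rewrite /= /all_or_zero /first_nonzero.
  by case: ifP => // /forallP []; move=> j; rewrite ffunE.
case: pickP => [j _|/(_ j0)]; first by rewrite ffunE.
by rewrite ffunE => /negbFE/eqP.
Qed.

End Rows.

Theorem theorem8p10
  (n : nat) (M : machine n) (kappa : nat)
  (hM : standing M kappa) (hgen : init_generates_halt M)
  (m k : nat) (f : {ffun 'I_k -> elt n} -> elt n)
  (hf : forall (p : nat) (S : {set power 'I_p n}),
      p < m -> subuniverse M S -> preserves f S)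
  (g : 'I_k -> power 'I_m n) (R : {set power 'I_m n})
  (hR : R = Sg M [set g l | l : 'I_k])
  (hcomp : computational R) (hnonhalt : ~ halting R)
  (NN : {set 'I_m}) (hNN : isNset kappa R NN)
  (alpha : power 'I_m n) (halpha : apply_op f g = alpha)
  (hY : alpha \in Ypow n 'I_m)
  (hcard : 11 <= #|~: Dset R|)
  (huniq : forall k1 k2 : 'I_m,
      k1 \notin NN -> k2 \notin NN ->
      proj [set~ k1] alpha \in projR [set~ k1] (RI M R) ->
      proj [set~ k2] alpha \in projR [set~ k2] (RI M R) ->
      k1 = k2) :
  alpha \in R.
Proof.
have Rst : stable M R by rewrite hR; apply: Sg_stable.
have GR : [set g l | l : 'I_k] \subset R by rewrite hR sub_Sg.
have gR l : g l \in R by apply: (subsetP GR); apply: imset_f.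
have {}hY i : inY (alpha i) by move: hY; rewrite inE => /forallP.
(* Eleven exceeds 5 times 2, so some content occurs at three or more dot-free coordinates. *)
have [a] := content_pigeonhole (k := 2) (fun i => Content (alpha i)) hcard.
case/card_geqP=> s [s_uniq /eqP s_size s_sub].
pose iota := tnth (Tuple s_size).
have iota_inj : injective iota by apply/tuple_uniqP.
have iotaP j : iota j \notin Dset R /\ Content (alpha (iota j)) = a.
  have /s_sub : iota j \in s by apply: (mem_tnth j (Tuple s_size)).
  by rewrite !inE => /andP [h /eqP].
have dotfree r j : r \in R -> ~~ inD (r (iota j)).
  move=> hr; have [+ _] := iotaP j; apply: contra => h; rewrite inE.
  by apply/exists_inP; exists r.
have m_gt : 11 <= m by rewrite -[m]card_ord (leq_trans hcard) ?max_card.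
have hfI := preserves_finType hf.
pose fus : power 'I_m n -> _ := fuse ord0 iota (row a).
have sel := row_selective a (@ord0 2).
pose beta := apply_op f (fun l => fus (g l)).
have betaP b : (forall j, beta (inr b) = alpha (iota j)).
  (* The three rows to be fused are put next to one new row. The columns lie in a graph of arity 4,
     which [f] preserves since [m] is at least 11. *)
  pose h l : power (option 'I_3) n :=
    [ffun o => if o is Some j then g l (iota j) else fus (g l) (inr b)].
  have hG : apply_op f h \in graph n (row a b).
    apply: hfI => [||l]; first by rewrite card_option card_ord; apply: leq_trans m_gt.
      exact: (graph_stable _ (@ord0 2)).
    apply/graphP; split=> [j|o|]; rewrite ?ffunE.
    + exact: (sync hcomp).
    + case: o => [j|]; first exact: dotfree.
      exact: (fuse_row_dotfree ord0 dotfree sel b (gR l)).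
    + move=> hl; rewrite /fuse_row ifT; last first.
        by apply/forallP => j; have := hl j; rewrite ffunE.
      by congr (row a b _); apply/ffunP => j; rewrite !ffunE.
  have eS j : apply_op f h (Some j) = alpha (iota j).
    by rewrite -halpha !ffunE; congr f; apply/ffunP => l; rewrite !ffunE.
  have eN : apply_op f h None = beta (inr b).
    by rewrite !ffunE; congr f; apply/ffunP => l; rewrite !ffunE.
  have [e1 _ e2] := graphP _ _ hG.
  move=> j; rewrite -eN -eS; apply: elt_eq; first by rewrite e1.
  rewrite e2 => [|j']; last by rewrite eS.
  (* As [alpha] has content [a] at all three coordinates, both selections return [a]. *)
  rewrite eS; have [_ ->] := iotaP j; rewrite -[RHS](row_const a (@ord0 2) b).
  by congr (row a b _); apply/ffunP => j'; rewrite [LHS]ffunE [RHS]ffunE eS; case: (iotaP j').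
have beta_rest o : beta (inl o) = alpha (val o).
  by rewrite -halpha !ffunE; congr f; apply/ffunP => l; rewrite !ffunE.
(* Three coordinates are replaced by two, so the arity is [m - 1]. *)
have card_merged : #|{: {i | i \notin codom iota} + bool}| < m.
  rewrite card_sum card_bool card_sig.
  have e := cardC [in codom iota]; rewrite card_codom // !card_ord in e.
  by rewrite -[X in _ < X]e addnC.
have beta_in : beta \in Sg M [set fus r | r in [set g l | l : 'I_k]].
  apply: hfI => // [|l]; first exact: Sg_stable.
  by apply: (subsetP (sub_Sg _ _)); do 2 apply: imset_f.
have beta_Y t : inY (beta t).
  by case: t => [o|b]; [rewrite beta_rest|rewrite (betaP b ord0)].
(* Both new rows of [beta] carry the common value of [alpha], so [beta] lifts to a tuple of [R] with
   this value at all three coordinates: [alpha] itself. *)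
have beta_lift : liftable [:: Zero; a] beta.
  rewrite /liftable !(betaP _ ord0) eqxx; have [_ ->] := iotaP ord0.
  by rewrite !inE eqxx orbT.
have [|r hr [r1 r2]] := Sg_fuse_lift Rst hcomp GR dotfree sel _ (@row_inj _ a) beta_in beta_Y beta_lift.
  by rewrite inE.
suff -> : alpha = r by [].
apply/ffunP => i; case: (boolP (i \in codom iota)) => [/codomP [j ->]|hi].
  by rewrite r2 (betaP _ j).
by rewrite -(beta_rest (Sub i hi)) -r1.
Qed.
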